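(* Let $G=\mathbb{Z}_m\times\mathbb{Z}_n$ with $m\mid n$, $m=\mathsf m^2$, $n=\mathsf n^2$, and let $h_1,h_2$ be standard generators of $G$ (of orders $m,n$). Let $0\le a,b<\mathsf m$ and $0\le c<\mathsf n$ be integers. Let $J_{a,b,c}\in kG\otimes kG$ and $\Phi_{a,b,c}\in (kG)^{\otimes 3}$ be $$J_{a,b,c}=\sum_{0\le x_1,y_1<m}\ \sum_{0\le x_2,y_2<n}\zeta_m^{(ax_1+bx_2)(y_1-y_1')}\zeta_n^{cx_2(y_2-y_2'')}\,1_{x_1}1_{x_2}\otimes1_{y_1}1_{y_2},$$ $$\Phi_{a,b,c}=\sum_{0\le i_1,j_1,k_1<\mathsf m}\ \sum_{0\le i_2,j_2,k_2<\mathsf n}\zeta_{\mathsf m}^{(ai_1+bi_2)\left[\frac{j_1+k_1}{\mathsf m}\right]}\zeta_{\mathsf n}^{ci_2\left[\frac{j_2+k_2}{\mathsf n}\right]}\,\mathbf 1_{i_1}\mathbf 1_{i_2}\otimes\mathbf 1_{j_1}\mathbf 1_{j_2}\otimes\mathbf 1_{k_1}\mathbf 1_{k_2}.$$ Then $d(J_{a,b,c})=\Phi_{a,b,c}$, where $d(J)=(1\otimes J)(\mathrm{id}\otimes\Delta)(J)(\Delta\otimes\mathrm{id})(J^{-1})(J^{-1}\otimes1)$.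
   Context: $k$ is an algebraically closed field of characteristic zero. $\Delta$ is the usual comultiplication of $kG$ ($\Delta(g)=g\otimes g$ for $g\in G$). $[\cdot]$ is the floor function. For an integer $i$, $i'$ and $i''$ are the remainders of $i$ modulo $\mathsf m$ and $\mathsf n$. $\zeta_l$ is a fixed primitive $l$-th root of unity, chosen compatibly: $\zeta_m^{\mathsf m}=\zeta_{\mathsf m}$, $\zeta_n^{\mathsf n}=\zeta_{\mathsf n}$ (and $\zeta_n^{n/m}=\zeta_m$). Indices 1 and 2 refer to $h_1$ and $h_2$: $1_{x_1}=\frac1m\sum_{j=0}^{m-1}\zeta_m^{-x_1j}h_1^j$, $1_{x_2}=\frac1n\sum_{j=0}^{n-1}\zeta_n^{-x_2j}h_2^j$, and, with $\mathsf h_1=h_1^{\mathsf m}$ and $\mathsf h_2=h_2^{\mathsf n}$, $\mathbf 1_{i_1}=\frac1{\mathsf m}\sum_{j=0}^{\mathsf m-1}\zeta_{\mathsf m}^{-i_1j}\mathsf h_1^j$, $\mathbf 1_{i_2}=\frac1{\mathsf n}\sum_{j=0}^{\mathsf n-1}\zeta_{\mathsf n}^{-i_2j}\mathsf h_2^j$. Standard generators $h_1,h_2$ are the images of the canonical generators of $\mathbb{Z}_m\times\mathbb{Z}_n$ under some automorphism. *)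

(* Defs.v *)
From HB Require Import structures.
From mathcomp Require Import all_boot all_order all_algebra.
From mathcomp Require Import all_fingroup all_solvable all_field.

Set Implicit Arguments.
Unset Strict Implicit.
Unset Printing Implicit Defensive.

Import GRing.Theory.
Local Open Scope ring_scope.

(* The group algebra kG of a finite group, as the functions G -> k with the   *)
(* convolution product; [gelt g] is the basis element g. The alias hides the  *)
(* pointwise product that the library puts on {ffun gT -> k}.                 *)
Definition galg (k : fieldType) (gT : finGroupType) : Type :=
  {ffun gT -> k^o}.

Section GroupAlgebra.
Variables (k : fieldType) (gT : finGroupType).
Implicit Types (u v w : galg k gT) (g h : gT).

HB.instance Definition _ := Vector.on (galg k gT).

Definition gelt g : galg k gT := [ffun h => (h == g)%:R].

Definition galg_mul u v : galg k gT :=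
  [ffun g => \sum_h u h * v (h^-1 * g)%g].

Fact galg_mulE u v g : galg_mul u v g = \sum_h u h * v (h^-1 * g)%g.
Proof. by rewrite ffunE. Qed.

Fact galg_mulA : associative galg_mul.
Proof.
move=> u v w; apply/ffunP=> g; rewrite !galg_mulE.
under eq_bigr do rewrite galg_mulE mulr_sumr.
under [RHS]eq_bigr do rewrite galg_mulE mulr_suml.
rewrite [RHS]exchange_big /=; apply: eq_bigr => h _.
rewrite [RHS](reindex_inj (mulgI h)) /=; apply: eq_bigr => x _.
by rewrite mulKg invMg !mulgA mulrA.
Qed.

Fact galg_mul1 : left_id (gelt 1) galg_mul.
Proof.
move=> u; apply/ffunP=> g; rewrite galg_mulE (bigD1 1%g) //= big1 ?addr0.
  by rewrite ffunE eqxx mul1r invg1 mul1g.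
by move=> h /negPf h1; rewrite ffunE h1 mul0r.
Qed.

Fact galg_mulr1 : right_id (gelt 1) galg_mul.
Proof.
move=> u; apply/ffunP=> g; rewrite galg_mulE (bigD1 g) //= big1 ?addr0.
  by rewrite ffunE mulVg eqxx mulr1.
move=> h hg; rewrite ffunE -(inj_eq (mulgI h)) mulKVg mulg1 eq_sym.
by rewrite (negPf hg) mulr0.
Qed.

Fact galg_mulDl : left_distributive galg_mul +%R.
Proof.
move=> u v w; apply/ffunP=> g; rewrite galg_mulE [RHS]ffunE !galg_mulE -big_split /=.
by apply: eq_bigr => h _; rewrite ffunE mulrDl.
Qed.

Fact galg_mulDr : right_distributive galg_mul +%R.
Proof.
move=> u v w; apply/ffunP=> g; rewrite galg_mulE [RHS]ffunE !galg_mulE -big_split /=.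
by apply: eq_bigr => h _; rewrite ffunE mulrDr.
Qed.

Fact galg_1neq0 : gelt 1 != 0.
Proof.
by apply/eqP=> /ffunP/(_ 1%g)/eqP; rewrite !ffunE eqxx oner_eq0.
Qed.

HB.instance Definition _ := GRing.Zmodule_isNzRing.Build (galg k gT)
  galg_mulA galg_mul1 galg_mulr1 galg_mulDl galg_mulDr galg_1neq0.

Fact galg_scaleAl (c : k) u v : c *: (u * v) = (c *: u) * v.
Proof.
apply/ffunP=> g; rewrite [LHS]ffunE !galg_mulE scaler_sumr.
by apply: eq_bigr => h _; rewrite ffunE scalerAl.
Qed.

HB.instance Definition _ :=
  GRing.Lmodule_isLalgebra.Build k (galg k gT) galg_scaleAl.

Fact galg_scaleAr (c : k) u v : c *: (u * v) = u * (c *: v).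
Proof.
apply/ffunP=> g; rewrite [LHS]ffunE !galg_mulE scaler_sumr.
by apply: eq_bigr => h _; rewrite ffunE scalerAr.
Qed.

HB.instance Definition _ :=
  GRing.Lalgebra_isAlgebra.Build k (galg k gT) galg_scaleAr.

(* Provides the unit predicate and the inverse of kG. *)
HB.instance Definition _ := Algebra_isFalgebra.Build k (galg k gT).

Lemma geltM g h : gelt (g * h) = gelt g * gelt h.
Proof.
apply/ffunP=> x; rewrite galg_mulE (bigD1 g) //= big1 ?addr0.
  by rewrite !ffunE eqxx mul1r -[in RHS](inj_eq (mulgI g)) mulKVg.
by move=> y /negPf yg; rewrite [gelt g y]ffunE yg mul0r.
Qed.

Lemma galg_basis u : u = \sum_g u g *: gelt g.
Proof.
apply/ffunP=> x; rewrite sum_ffunE (bigD1 x) //= big1 ?addr0.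
  by rewrite !ffunE eqxx [RHS]mulr1.
by move=> y yx; rewrite !ffunE eq_sym (negPf yx) scaler0.
Qed.

End GroupAlgebra.

Arguments gelt k {gT} g.

(* The library's direct product of groups, named by its canonical instance so *)
(* that nested products elaborate to small terms.                             *)
Notation "gT × hT" := (Datatypes_prod__canonical__fingroup_FinGroup gT hT)
  (at level 40, left associativity) : type_scope.

(* kG ⊗ kH is identified with k[G x H], where g ⊗ h is the pair (g, h); the   *)
(* lemmas below show that this is the tensor product of algebras.             *)
Definition tensor (k : fieldType) (gT hT : finGroupType)
    (u : galg k gT) (v : galg k hT) : galg k (gT × hT) :=
  [ffun x => u x.1 * v x.2].

Notation "u ⊗ v" := (tensor u v)
  (at level 40, left associativity) : ring_scope.

(* f ⊗ f' for linear maps f and f'. *)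
Definition tensor_map (k : fieldType) (gT hT gT' hT' : finGroupType)
    (f : galg k gT -> galg k gT') (f' : galg k hT -> galg k hT')
    (u : galg k (gT × hT)) : galg k (gT' × hT') :=
  \sum_x u x *: (f (gelt k x.1) ⊗ f' (gelt k x.2)).

(* The associativity isomorphism A ⊗ (B ⊗ C) -> (A ⊗ B) ⊗ C. *)
Definition tensor_assoc (k : fieldType) (gT hT lT : finGroupType)
    (u : galg k (gT × (hT × lT))) : galg k (gT × hT × lT) :=
  [ffun x => u (x.1.1, (x.1.2, x.2))].

Definition comul (k : fieldType) (gT : finGroupType) (u : galg k gT) :
    galg k (gT × gT) :=
  \sum_g u g *: (gelt k g ⊗ gelt k g).

Section TensorTheory.
Variables (k : fieldType) (gT hT lT : finGroupType).

Lemma tensor_gelt (g : gT) (h : hT) : gelt k g ⊗ gelt k h = gelt k (g, h).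
Proof. by apply/ffunP=> -[x y]; rewrite !ffunE /= xpair_eqE -natrM mulnb. Qed.

Lemma tensor_linearl (c : k) (u u' : galg k gT) (v : galg k hT) :
  (c *: u + u') ⊗ v = c *: (u ⊗ v) + u' ⊗ v.
Proof. by apply/ffunP=> x; rewrite !ffunE mulrDl scalerAl. Qed.

Lemma tensor_linearr (c : k) (u : galg k gT) (v v' : galg k hT) :
  u ⊗ (c *: v + v') = c *: (u ⊗ v) + u ⊗ v'.
Proof. by apply/ffunP=> x; rewrite !ffunE mulrDr scalerAr. Qed.

Lemma tensorM (u u' : galg k gT) (v v' : galg k hT) :
  (u * u') ⊗ (v * v') = (u ⊗ v) * (u' ⊗ v').
Proof.
apply/ffunP=> -[x y]; rewrite galg_mulE ffunE /= !galg_mulE big_distrlr /=.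
rewrite pair_big /=; apply: eq_bigr => -[g h] _.
by rewrite !ffunE /= mulrACA.
Qed.

Lemma tensor1 : (1 : galg k gT) ⊗ (1 : galg k hT) = 1.
Proof. exact: tensor_gelt. Qed.

Lemma tensor_universal (V : lmodType k) (b : galg k gT -> galg k hT -> V) :
    (forall v, linear (b^~ v)) -> (forall u, linear (b u)) ->
  exists! F : {ffun gT × hT -> V},
    forall u v, b u v = \sum_x (u ⊗ v) x *: F x.
Proof.
move=> bl br; exists [ffun x => b (gelt k x.1) (gelt k x.2)]; split=> [u v|F bF].
  have suml I (r : seq I) (c : I -> k) (e : I -> galg k gT) w :
      b (\sum_(i <- r) c i *: e i) w = \sum_(i <- r) c i *: b (e i) w.
    elim: r => [|i r IHr]; last by rewrite !big_cons bl IHr.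
    rewrite !big_nil; have /= := bl w (-1) 0 0.
    by rewrite scaler0 addr0 scaleN1r addNr.
  have sumr I (r : seq I) (c : I -> k) (e : I -> galg k hT) w :
      b w (\sum_(i <- r) c i *: e i) = \sum_(i <- r) c i *: b w (e i).
    elim: r => [|i r IHr]; last by rewrite !big_cons br IHr.
    rewrite !big_nil; have /= := br w (-1) 0 0.
    by rewrite scaler0 addr0 scaleN1r addNr.
  rewrite {1}(galg_basis u) suml; under eq_bigr => g _.
    rewrite {1}(galg_basis v) sumr scaler_sumr.
    by under eq_bigr do rewrite scalerA; over.
  by rewrite pair_big /=; apply: eq_bigr => -[g h] _; rewrite !ffunE.
apply/ffunP=> -[g h]; rewrite ffunE bF tensor_gelt (bigD1 (g, h)) //= big1.
  by rewrite addr0 ffunE eqxx scale1r.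
by move=> x /negPf xgh; rewrite ffunE xgh scale0r.
Qed.

Lemma tensor_assocE (u : galg k gT) (v : galg k hT) (w : galg k lT) :
  tensor_assoc (u ⊗ (v ⊗ w)) = u ⊗ v ⊗ w.
Proof. by apply/ffunP=> x; rewrite !ffunE /= mulrA. Qed.

Lemma comul_gelt (g : gT) : comul (gelt k g) = gelt k g ⊗ gelt k g.
Proof.
rewrite /comul (bigD1 g) //= big1 ?addr0 ?ffunE ?eqxx ?scale1r // => h hg.
by rewrite ffunE (negPf hg) scale0r.
Qed.

End TensorTheory.

Lemma tensor_mapE (k : fieldType) (gT hT gT' hT' : finGroupType)
    (f : {linear galg k gT -> galg k gT'})
    (f' : {linear galg k hT -> galg k hT'}) u v :
  tensor_map f f' (u ⊗ v) = f u ⊗ f' v.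
Proof.
pose b (x : galg k gT) (y : galg k hT) := f x ⊗ f' y.
have bl y : linear (b^~ y).
  by move=> c x x'; rewrite /b /= linearP tensor_linearl.
have br x : linear (b x).
  by move=> c y y'; rewrite /b /= linearP tensor_linearr.
have [F [bF _]] := tensor_universal bl br.
rewrite [RHS]bF; apply: eq_bigr => -[g h] _; congr (_ *: _).
rewrite [LHS](bF (gelt k g) (gelt k h)) tensor_gelt (bigD1 (g, h)) //= big1.
  by rewrite addr0 ffunE eqxx scale1r.
by move=> x /negPf xgh; rewrite ffunE xgh scale0r.
Qed.

(* J^-1 is the inverse only when J is a unit (otherwise it is J). *)
Definition twist_d (k : fieldType) (gT : finGroupType)
    (J : galg k (gT × gT)) : galg k (gT × gT × gT) :=
  tensor_assoc (1 ⊗ J) * tensor_assoc (tensor_map id (@comul k gT) J)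
    * tensor_map (@comul k gT) id J^-1 * (J^-1 ⊗ 1).

(* Z_m is 'I_m.-1.+1, i.e. 'I_m for m > 0: unlike 'Z_m it is also right for   *)
(* m = 1.                                                                     *)
Definition Zprod (m n : nat) : finGroupType :=
  Eval cbv [reverse_coercion] in
  ('I_m.-1.+1 : finGroupType) × ('I_n.-1.+1 : finGroupType).

Definition standard_generators (m n : nat) (h1 h2 : Zprod m n) : Prop :=
  exists2 s : {perm Zprod m n}, s \in Aut [set: Zprod m n] &
    h1 = s (Zp1, 1%g) /\ h2 = s (1%g, Zp1).

(* (1/l) sum_(j < l) z^(-x j) u^j: this is 1_x for (z, l, u) = (zeta_m, m, h),*)
(* and bold 1_x for (zeta_sm, sm, h^sm) where m = sm^2.                       *)
Definition idem (k : fieldType) (A : algType k) (z : k) (l : nat) (u : A)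
    (x : nat) : A :=
  l%:R^-1 *: \sum_(j < l) z ^- (x * j) *: u ^+ j.

Section TwistAssociator.
Variables (k : fieldType) (gT : finGroupType) (zeta : nat -> k).
Variables (sm sn : nat) (h1 h2 : gT) (a b c : nat).
Let m := (sm ^ 2)%N.
Let n := (sn ^ 2)%N.

Definition twistJ : galg k (gT × gT) :=
  let e1 := idem (zeta m) m (gelt k h1) in
  let e2 := idem (zeta n) n (gelt k h2) in
  \sum_(x1 < m) \sum_(y1 < m) \sum_(x2 < n) \sum_(y2 < n)
    (zeta m ^+ ((a * x1 + b * x2) * (y1 - y1 %% sm))
     * zeta n ^+ (c * x2 * (y2 - y2 %% sn)))
    *: ((e1 x1 * e2 x2) ⊗ (e1 y1 * e2 y2)).

Definition assocPhi : galg k (gT × gT × gT) :=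
  let e1 := idem (zeta sm) sm (gelt k h1 ^+ sm) in
  let e2 := idem (zeta sn) sn (gelt k h2 ^+ sn) in
  \sum_(i1 < sm) \sum_(j1 < sm) \sum_(k1 < sm)
  \sum_(i2 < sn) \sum_(j2 < sn) \sum_(k2 < sn)
    (zeta sm ^+ ((a * i1 + b * i2) * ((j1 + k1) %/ sm))
     * zeta sn ^+ (c * i2 * ((j2 + k2) %/ sn)))
    *: ((e1 i1 * e2 i2) ⊗ (e1 j1 * e2 j2) ⊗ (e1 k1 * e2 k2)).

End TwistAssociator.

(* Main.v *)
From HB Require Import structures.
Require Import Defs.
From mathcomp Require Import all_boot all_order all_algebra.
From mathcomp Require Import all_fingroup all_solvable all_field.
From mathcomp Require Import zify.

Local Open Scope ring_scope.

Set Implicit Arguments.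
Unset Strict Implicit.
Unset Printing Implicit Defensive.

Import GRing.Theory.

(** The group algebra of an abelian group is an algebra of functions on its
characters: evaluation of [u] at a character [chi], the sum of the
[u g * chi g], is an algebra morphism, and two elements with the same values
at all characters agree. Under this Fourier transform every ingredient of the
proposition becomes elementary. A tensor product is evaluated factor by factor
([ev_tensor]), and the comultiplication multiplies characters
([ev_comul_gelt]), so that the value of [twist_d J] at a triple
[(chi, psi, om)] is
  [J(psi, om) J(chi, psi om) / (J(chi psi, om) J(chi, psi))]
([ev_twist_d]). The idempotents are indicator functions ([ev_idem]).

Index a character by exponents [x = (x1, x2)], where its values at the two
generators are [zeta_m ^ x1] and [zeta_n ^ x2]. As [y - y %% sm] is
[sm * (y %/ sm)] and [zeta_m ^ sm = zeta_sm], the twist becomes the function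
  [f(x, y) = zeta_sm ^ ((a x1 + b x2) (y1 %/ sm)) zeta_sn ^ (c x2 (y2 %/ sn))]
([ev_twistJ]). It never vanishes, hence the twist is a unit. It is
multiplicative in [x], which reduces the quotient above to
[f(x, y + z) / (f(x, y) f(x, z))]; this measures the failure of [y |-> y %/ d]
to be additive, which is the carry [(y %% d + z %% d) %/ d] ([divnD_carry]).
These carries are exactly the exponents of the associator ([ev_assocPhi]).

That the characters separate the elements of the group algebra passes to
products of groups, and for a cyclic group it says that a polynomial of degree
less than [l] that vanishes at all [l]-th roots of unity is zero. *)

(** * Evaluation of a group algebra at the characters of the group *)

(** In finite dimension, right multiplication by [u] is onto as soon as it is
injective, and a preimage of 1 is then an inverse of [u]. *)
Lemma falg_regular_unit (k : fieldType) (A : falgType k) (u : A) :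
  (forall v, v * u = 0 -> v = 0) -> u \is a GRing.unit.
Proof.
move=> reg_u; apply/unitrP.
have ker_u: lker (amulr u) == 0%VS.
  rewrite eqEsubv sub0v andbT; apply/subvP=> v; rewrite memv_ker lfunE /=.
  by move/eqP/reg_u->; rewrite mem0v.
have /memv_imgP[v _]: 1 \in limg (amulr u).
  suffices /eqP->: limg (amulr u) == fullv by rewrite memvf.
  by rewrite -dimv_leqif_eq ?subvf ?limg_dim_eq // (eqP ker_u) capv0.
rewrite lfunE /= => vu1; exists v; split=> //; apply: (lker0P ker_u).
by rewrite !lfunE /= -mulrA -vu1 mulr1 mul1r.
Qed.

Lemma prim_root_neq0 (k : fieldType) l (z : k) :
  l.-primitive_root z -> z != 0.
Proof.
move=> z_prim; have := expf_eq0 z l.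
by rewrite prim_expr_order // oner_eq0 (prim_order_gt0 z_prim) => /esym/negbT.
Qed.

Section Evaluation.

Variables (k : fieldType) (gT : finGroupType).
Implicit Types (chi : gT -> k) (u v : galg k gT).

Definition is_character chi :=
  chi 1%g = 1 /\ {morph chi : g h / (g * h)%g >-> g * h}.

Lemma is_characterM {chi psi : gT -> k} :
  is_character chi -> is_character psi ->
  is_character (fun g => chi g * psi g).
Proof.
move=> [chi1 chiM] [psi1 psiM]; split=> [|g h].
  by rewrite chi1 psi1 mulr1.
by rewrite chiM psiM mulrACA.
Qed.

Definition ev chi u : k := \sum_g u g * chi g.

Fact ev_is_linear chi : linear_for *%R (ev chi).
Proof.
move=> c u v; rewrite /ev mulr_sumr -big_split; apply: eq_bigr => g _ /=.
by rewrite !ffunE mulrDl mulrA.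
Qed.

HB.instance Definition _ chi :=
  GRing.isLinear.Build k (galg k gT) k *%R (ev chi) (ev_is_linear chi).

Lemma ev_gelt chi g : ev chi (gelt k g) = chi g.
Proof.
rewrite /ev (bigD1 g) //= big1 ?addr0; first by rewrite ffunE eqxx mul1r.
by move=> h /negPf hg; rewrite ffunE hg mul0r.
Qed.

Lemma ev1 {chi} : is_character chi -> ev chi 1 = 1.
Proof. by case=> chi1 _; rewrite -chi1 -ev_gelt. Qed.

Lemma evM {chi} : is_character chi -> {morph ev chi : u v / u * v}.
Proof.
case=> _ chiM u v; rewrite {1}/ev.
under eq_bigr do rewrite galg_mulE mulr_suml.
rewrite exchange_big /= mulr_suml; apply: eq_bigr => h _.
rewrite (reindex_inj (mulgI h)) mulr_sumr; apply: eq_bigr => g _ /=.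
by rewrite mulKg chiM mulrACA.
Qed.

Lemma evX {chi} : is_character chi -> forall n, {morph ev chi : u / u ^+ n}.
Proof.
move=> chiP n u; elim: n => [|n IHn]; first exact: ev1.
by rewrite !exprS evM // IHn.
Qed.

Lemma evV {chi} u :
  is_character chi -> u \is a GRing.unit -> ev chi u^-1 = (ev chi u)^-1.
Proof.
move=> chiP Uu; have uV1: ev chi u * ev chi u^-1 = 1.
  by rewrite -evM // divrr // ev1.
rewrite -[RHS]mulr1 -uV1 mulKf //; apply: contra_eq_neq uV1 => ->.
by rewrite mul0r eq_sym oner_eq0.
Qed.

Definition separating X (chi : X -> gT -> k) :=
  forall u, (forall x, ev (chi x) u = 0) -> u = 0.

Lemma separating_eq X (chi : X -> gT -> k) u v :
  separating chi -> (forall x, ev (chi x) u = ev (chi x) v) -> u = v.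
Proof.
move=> sep uv; apply/eqP; rewrite -subr_eq0; apply/eqP/sep => x.
by rewrite linearB /= uv subrr.
Qed.

(** If no value of [u] is zero, then [v * u = 0] forces all values of [v] to be
zero, so that [u] is regular, hence a unit. *)
Lemma separating_unit X (chi : X -> gT -> k) u :
  separating chi -> (forall x, is_character (chi x)) ->
  (forall x, ev (chi x) u != 0) -> u \is a GRing.unit.
Proof.
move=> sep chiP nz_u; apply: falg_regular_unit => v vu0; apply: sep => x.
apply/eqP; have /eqP := congr1 (ev (chi x)) vu0.
by rewrite evM // linear0 mulf_eq0 (negPf (nz_u x)) orbF.
Qed.

(** The idempotent of index [x] is the indicator function of the characters with
value [z ^+ x] at [u]: its value is the mean of the powers of the [l]-th root of
unity [z ^+ y / z ^+ x], which is zero unless that root is 1. *)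
Lemma ev_idem chi (z : k) l u x y :
  is_character chi -> l.-primitive_root z -> ev chi u = z ^+ y ->
  ev chi (idem z l u x) = (x == y %[mod l])%:R.
Proof.
move=> chiP z_prim chi_u; have l_neq0 := prim_root_natf_neq0 z_prim.
have z_neq0 := prim_root_neq0 z_prim.
pose w := z ^+ y / z ^+ x.
have ->: ev chi (idem z l u x) = l%:R^-1 * \sum_(j < l) w ^+ j.
  rewrite /idem linearZ linear_sum /=; congr (_ * _); apply: eq_bigr => j _.
  by rewrite linearZ /= evX // chi_u mulrC expr_div_n -!exprM.
have wl1: w ^+ l = 1.
  by rewrite expr_div_n -!exprM [(y * l)%N]mulnC [(x * l)%N]mulnC !exprM
             (prim_expr_order z_prim) !expr1n divr1.
rewrite -(eq_prim_root_expr z_prim); have [zxy|zxy] := eqVneq.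
  rewrite /w zxy divff ?expf_neq0 //.
  under eq_bigr do rewrite expr1n.
  by rewrite sumr_const card_ord mulVf.
have w_neq1: w - 1 != 0.
  rewrite subr_eq0; apply: contraNneq zxy => w1.
  by rewrite -[z ^+ y](divfK (expf_neq0 x z_neq0)) -/w w1 mul1r.
have /esym/eqP := subrX1 w l.
by rewrite wl1 subrr mulf_eq0 (negPf w_neq1) => /eqP->; rewrite mulr0.
Qed.

End Evaluation.

Section EvaluationTensor.

Variables (k : fieldType) (gT hT : finGroupType).

Definition tchar (chi : gT -> k) (psi : hT -> k) (x : gT × hT) : k :=
  chi x.1 * psi x.2.

Lemma tchar_is_character {chi psi} :
  is_character chi -> is_character psi ->
  is_character (tchar chi psi).
Proof.
move=> [chi1 chiM] [psi1 psiM]; split; first by rewrite /tchar chi1 psi1 mulr1.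
by move=> x y; rewrite /tchar chiM psiM mulrACA.
Qed.

Lemma ev_tensor chi psi u v :
  ev (tchar chi psi) (u ⊗ v) = ev chi u * ev psi v.
Proof.
rewrite /ev big_distrlr /= pair_big /=; apply: eq_bigr => x _.
by rewrite ffunE mulrACA.
Qed.

(** A function on a product of groups is tested in one variable at a time:
evaluating it at [psi] in the second variable leaves an element of the group
algebra of the first group. *)
Lemma separating_tchar X Y (chi : X -> gT -> k) (psi : Y -> hT -> k) :
  separating chi -> separating psi ->
  separating (fun xy => tchar (chi xy.1) (psi xy.2)).
Proof.
move=> sepX sepY u u0.
pose row g : galg k hT := [ffun h => u (g, h)].
suffices row0 g: row g = 0.
  by apply/ffunP=> -[g h]; have /ffunP/(_ h) := row0 g; rewrite !ffunE.
apply: sepY => y; pose col : galg k gT := [ffun g => ev (psi y) (row g)].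
suffices /ffunP/(_ g): col = 0 by rewrite !ffunE.
apply: sepX => x; rewrite -[RHS](u0 (x, y)) /ev.
under eq_bigr do rewrite ffunE mulr_suml.
rewrite pair_big /=; apply: eq_bigr => -[g1 h1] _.
by rewrite ffunE /tchar /= mulrAC mulrA.
Qed.

End EvaluationTensor.

Lemma ev_tensor_assoc (k : fieldType) (gT hT lT : finGroupType)
    (chi : gT -> k) (psi : hT -> k) (om : lT -> k)
    (u : galg k (gT × (hT × lT))) :
  ev (tchar (tchar chi psi) om) (tensor_assoc u)
  = ev (tchar chi (tchar psi om)) u.
Proof.
rewrite /ev (reindex (fun x : gT * (hT * lT) => (x.1, x.2.1, x.2.2))) /=.
  by apply: eq_bigr => -[g [h l]] _; rewrite ffunE /tchar /= mulrA.
by exists (fun x => (x.1.1, (x.1.2, x.2))) => [[g [h l]]|[[g h] l]].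
Qed.

(** Only the values of [chi'] on the images of group elements matter: for
[f = id] take [chi = chi'], while for the comultiplication and a pair of
characters take [chi] to be their product. *)
Lemma ev_tensor_map (k : fieldType) (gT hT gT' hT' : finGroupType)
    (f : galg k gT -> galg k gT') (f' : galg k hT -> galg k hT')
    (chi : gT -> k) (psi : hT -> k) (chi' : gT' -> k) (psi' : hT' -> k) u :
  (forall g, ev chi' (f (gelt k g)) = chi g) ->
  (forall h, ev psi' (f' (gelt k h)) = psi h) ->
  ev (tchar chi' psi') (tensor_map f f' u)
  = ev (tchar chi psi) u.
Proof.
move=> chiE psiE; rewrite /tensor_map linear_sum; apply: eq_bigr => x _ /=.
by rewrite linearZ /= ev_tensor chiE psiE.
Qed.

Lemma ev_comul_gelt (k : fieldType) (gT : finGroupType) (chi psi : gT -> k) g :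
  ev (tchar chi psi) (comul (gelt k g)) = chi g * psi g.
Proof. by rewrite comul_gelt ev_tensor !ev_gelt. Qed.

(** The Fourier transform of [d]: multiplication and inversion become pointwise,
and each comultiplication multiplies the two characters that it receives. *)
Lemma ev_twist_d (k : fieldType) (gT : finGroupType) (J : galg k (gT × gT))
    (chi psi om : gT -> k) :
  is_character chi -> is_character psi -> is_character om ->
  J \is a GRing.unit ->
  let evJ f g := ev (tchar f g) J in
  ev (tchar (tchar chi psi) om) (twist_d J)
  = evJ psi om * evJ chi (fun g => psi g * om g)
    / evJ (fun g => chi g * psi g) om / evJ chi psi.
Proof.
move=> chiP psiP omP UJ evJ.
have chipsiP := is_characterM chiP psiP.
have tP (f g : gT -> k) (fP : is_character f) (gP : is_character g) :=
  tchar_is_character fP gP.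
have t3P := tchar_is_character (tP _ _ chiP psiP) omP.
rewrite /twist_d !(evM t3P) !ev_tensor_assoc !ev_tensor !ev1 // mul1r mulr1.
rewrite (ev_tensor_map (chi := chi) (psi := fun g => psi g * om g)); first last.
- by move=> h; rewrite ev_comul_gelt.
- by move=> g; rewrite ev_gelt.
rewrite (ev_tensor_map (chi := fun g => chi g * psi g) (psi := om)); first last.
- by move=> h; rewrite ev_gelt.
- by move=> g; rewrite ev_comul_gelt.
by rewrite !evV //; apply: tP.
Qed.

(** * The twist and the associator as functions of the exponents *)

Lemma sum_delta (k : fieldType) (I : finType) (F : I -> k) (o : I) :
  \sum_i F i * (i == o)%:R = F o.
Proof.
rewrite (bigD1 o) //= eqxx mulr1 big1 ?addr0 // => i /negPf->.
by rewrite mulr0.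
Qed.

Lemma ord_eq_mod l (l_gt0 : (0 < l)%N) (i : 'I_l) x :
  (i == x %[mod l])%N = (i == Ordinal (ltn_pmod x l_gt0)).
Proof. by rewrite -val_eqE /= [(i %% l)%N]modn_small. Qed.

Lemma prim_expr_eqmod {k : fieldType} {l} {z : k} i j :
  l.-primitive_root z -> i = j %[mod l] -> z ^+ i = z ^+ j.
Proof.
by move=> z_prim ij; apply/eqP; rewrite (eq_prim_root_expr z_prim) ij.
Qed.

(** The sums defining the twist and the associator run over reduced exponents,
while products of characters produce unreduced ones; this reconciles them. *)
Lemma lin_eqmod d m n a b x y : (d %| m)%N -> (d %| n)%N ->
  (a * (x %% m) + b * (y %% n) = a * x + b * y %[mod d])%N.
Proof.
move=> dm dn; rewrite -modnDm -(modnMmr a) -(modnMmr b) !modn_dvdm //.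
by rewrite !modnMmr modnDm.
Qed.

Lemma divnD_carry d y z : (0 < d)%N ->
  ((y + z) %/ d = y %/ d + z %/ d + (y %% d + z %% d) %/ d)%N.
Proof.
move=> d_gt0; rewrite {1}(divn_eq y d) {1}(divn_eq z d) addnACA -mulnDl.
by rewrite divnMDl.
Qed.

(** [y - y %% d] is the multiple [d * (y %/ d)] of [d]. *)
Lemma expr_round (k : fieldType) (z z' : k) d A y :
  z ^+ d = z' -> z ^+ (A * (y - y %% d)) = z' ^+ (A * (y %/ d)).
Proof.
by move=> <-; rewrite {1}(divn_eq y d) addnK mulnA mulnC -exprM.
Qed.

Section TwistAssociatorValues.

Variables (k : fieldType) (gT : finGroupType) (zeta : nat -> k).
Variables (sm sn : nat) (h1 h2 : gT) (a b c : nat).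
Hypotheses (sm_gt0 : (0 < sm)%N) (sn_gt0 : (0 < sn)%N) (sm_sn : (sm %| sn)%N).
Hypothesis zeta_prim : forall l, (0 < l)%N -> l.-primitive_root (zeta l).
Hypothesis zeta_sm : zeta (sm ^ 2)%N ^+ sm = zeta sm.
Hypothesis zeta_sn : zeta (sn ^ 2)%N ^+ sn = zeta sn.

Notation m := (sm ^ 2)%N.
Notation n := (sn ^ 2)%N.

Let m_gt0 : (0 < m)%N. Proof. by rewrite expn_gt0 sm_gt0. Qed.
Let n_gt0 : (0 < n)%N. Proof. by rewrite expn_gt0 sn_gt0. Qed.

(** The exponents are arbitrary natural numbers, determined only modulo [m] and
[n], so that the exponents of a product of characters are the sums. *)
Definition has_exponents (chi : gT -> k) x1 x2 :=
  [/\ is_character chi, chi h1 = zeta m ^+ x1 & chi h2 = zeta n ^+ x2].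

Lemma has_exponentsM chi psi x1 x2 y1 y2 :
  has_exponents chi x1 x2 -> has_exponents psi y1 y2 ->
  has_exponents (fun g => chi g * psi g) (x1 + y1) (x2 + y2).
Proof.
move=> [chiP chi1 chi2] [psiP psi1 psi2].
split; first exact: is_characterM.
- by rewrite chi1 psi1 exprD.
- by rewrite chi2 psi2 exprD.
Qed.

(** In the defining sum only the term whose indices are the residues of the
exponents survives; its coefficient depends on these residues as on the
exponents themselves. Here [sm %| sn] is needed because [x2] is reduced modulo
[n] but occurs in an exponent of [zeta sm]. *)
Lemma ev_twistJ chi psi x1 x2 y1 y2 :
  has_exponents chi x1 x2 -> has_exponents psi y1 y2 ->
  ev (tchar chi psi) (twistJ zeta sm sn h1 h2 a b c)
  = zeta sm ^+ ((a * x1 + b * x2) * (y1 %/ sm))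
    * zeta sn ^+ (c * x2 * (y2 %/ sn)).
Proof.
move=> [chiP chi1 chi2] [psiP psi1 psi2].
rewrite /twistJ !pair_bigA /= linear_sum /=.
pose o := (Ordinal (ltn_pmod x1 m_gt0), Ordinal (ltn_pmod y1 m_gt0),
           Ordinal (ltn_pmod x2 n_gt0), Ordinal (ltn_pmod y2 n_gt0)).
pose F (i : 'I_m * 'I_m * 'I_n * 'I_n) :=
  zeta m ^+ ((a * i.1.1.1 + b * i.1.2) * (i.1.1.2 - i.1.1.2 %% sm))
  * zeta n ^+ (c * i.1.2 * (i.2 - i.2 %% sn)).
transitivity (\sum_i F i * (i == o)%:R).
  apply: eq_bigr => -[[[i1 j1] i2] j2] _ /=.
  rewrite linearZ /= ev_tensor !evM //.
  rewrite (ev_idem (y := x1) i1 chiP (zeta_prim m_gt0)) ?ev_gelt //.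
  rewrite (ev_idem (y := x2) i2 chiP (zeta_prim n_gt0)) ?ev_gelt //.
  rewrite (ev_idem (y := y1) j1 psiP (zeta_prim m_gt0)) ?ev_gelt //.
  rewrite (ev_idem (y := y2) j2 psiP (zeta_prim n_gt0)) ?ev_gelt //.
  rewrite (ord_eq_mod m_gt0) (ord_eq_mod n_gt0) (ord_eq_mod m_gt0).
  rewrite (ord_eq_mod n_gt0) -!natrM !mulnb !xpair_eqE.
  by congr (_ * (nat_of_bool _)%:R); rewrite andbACA andbA.
rewrite sum_delta /F /= (expr_round _ _ zeta_sm) (expr_round _ _ zeta_sn).
have d_m d : (d %| d ^ 2)%N by rewrite dvdn_exp.
rewrite -!mulnn -!modn_divl !mulnn.
congr (_ * _).
  apply: (prim_expr_eqmod (zeta_prim sm_gt0)).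
  by rewrite modnMmr -modnMml lin_eqmod ?modnMml // (dvdn_trans sm_sn).
apply: (prim_expr_eqmod (zeta_prim sn_gt0)).
rewrite modnMmr -modnMml; have := lin_eqmod c 0 x2 0 (d_m sn) (d_m sn).
by rewrite !mul0n !addn0 => ->; rewrite modnMml.
Qed.


(** The idempotents are now those of the powers [h1 ^+ sm] and [h2 ^+ sn], on
which the characters take the values [zeta sm ^+ x1] and [zeta sn ^+ x2], so
that the surviving indices are the residues modulo [sm] and [sn]. *)
Lemma ev_assocPhi chi psi om x1 x2 y1 y2 z1 z2 :
  has_exponents chi x1 x2 -> has_exponents psi y1 y2 ->
  has_exponents om z1 z2 ->
  ev (tchar (tchar chi psi) om) (assocPhi zeta sm sn h1 h2 a b c)
  = zeta sm ^+ ((a * x1 + b * x2) * ((y1 %% sm + z1 %% sm) %/ sm))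
    * zeta sn ^+ (c * x2 * ((y2 %% sn + z2 %% sn) %/ sn)).
Proof.
move=> [chiP chi1 chi2] [psiP psi1 psi2] [omP om1 om2].
rewrite /assocPhi !pair_bigA /= linear_sum /=.
pose o := (Ordinal (ltn_pmod x1 sm_gt0), Ordinal (ltn_pmod y1 sm_gt0),
           Ordinal (ltn_pmod z1 sm_gt0), Ordinal (ltn_pmod x2 sn_gt0),
           Ordinal (ltn_pmod y2 sn_gt0), Ordinal (ltn_pmod z2 sn_gt0)).
pose F (i : 'I_sm * 'I_sm * 'I_sm * 'I_sn * 'I_sn * 'I_sn) :=
  zeta sm ^+ ((a * i.1.1.1.1.1 + b * i.1.1.2)
              * ((i.1.1.1.1.2 + i.1.1.1.2) %/ sm))
  * zeta sn ^+ (c * i.1.1.2 * ((i.1.2 + i.2) %/ sn)).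
have ev_h1 f x : is_character f -> f h1 = zeta m ^+ x ->
    ev f (gelt k h1 ^+ sm) = zeta sm ^+ x.
  by move=> fP f1; rewrite evX // ev_gelt f1 exprAC zeta_sm.
have ev_h2 f x : is_character f -> f h2 = zeta n ^+ x ->
    ev f (gelt k h2 ^+ sn) = zeta sn ^+ x.
  by move=> fP f2; rewrite evX // ev_gelt f2 exprAC zeta_sn.
transitivity (\sum_i F i * (i == o)%:R).
  apply: eq_bigr => -[[[[[i1 j1] l1] i2] j2] l2] _ /=.
  rewrite linearZ /= !ev_tensor !evM //.
  rewrite (ev_idem i1 chiP (zeta_prim sm_gt0) (ev_h1 _ _ chiP chi1)).
  rewrite (ev_idem i2 chiP (zeta_prim sn_gt0) (ev_h2 _ _ chiP chi2)).
  rewrite (ev_idem j1 psiP (zeta_prim sm_gt0) (ev_h1 _ _ psiP psi1)).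
  rewrite (ev_idem j2 psiP (zeta_prim sn_gt0) (ev_h2 _ _ psiP psi2)).
  rewrite (ev_idem l1 omP (zeta_prim sm_gt0) (ev_h1 _ _ omP om1)).
  rewrite (ev_idem l2 omP (zeta_prim sn_gt0) (ev_h2 _ _ omP om2)).
  rewrite !(ord_eq_mod sm_gt0) !(ord_eq_mod sn_gt0) -!natrM !mulnb !xpair_eqE.
  congr (_ * (nat_of_bool _)%:R).
  by do !case: eqP => _.
rewrite sum_delta /F /=; congr (_ * _).
  apply: (prim_expr_eqmod (zeta_prim sm_gt0)).
  by rewrite -modnMml lin_eqmod ?modnMml.
apply: (prim_expr_eqmod (zeta_prim sn_gt0)).
rewrite -modnMml; have := lin_eqmod c 0 x2 0 (dvdnn sn) (dvdnn sn).
by rewrite !mul0n !addn0 => ->; rewrite modnMml.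
Qed.

(** The result for any group with enough characters of known exponents: after
evaluation it is an identity between powers of [zeta sm] and [zeta sn]. *)
Lemma twist_d_twistJ (chi : nat * nat -> gT -> k) :
  separating chi -> (forall x, has_exponents (chi x) x.1 x.2) ->
  twistJ zeta sm sn h1 h2 a b c \is a GRing.unit /\
  twist_d (twistJ zeta sm sn h1 h2 a b c) = assocPhi zeta sm sn h1 h2 a b c.
Proof.
move=> sep expP; have chiP x : is_character (chi x) by case: (expP x).
have zeta_neq0 l : (0 < l)%N -> zeta l != 0.
  by move/zeta_prim/prim_root_neq0.
have UJ: twistJ zeta sm sn h1 h2 a b c \is a GRing.unit.
  apply: (separating_unit (separating_tchar sep sep)) => [x|x].
    exact: tchar_is_character.
  by rewrite (ev_twistJ (expP _) (expP _)) mulf_neq0 ?expf_neq0 ?zeta_neq0.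
split=> //.
apply: (separating_eq (separating_tchar (separating_tchar sep sep) sep)).
move=> [[x y] z] /=.
rewrite ev_twist_d // (ev_assocPhi (expP _) (expP _) (expP _)).
have expM u v := has_exponentsM (expP u) (expP v).
rewrite (ev_twistJ (expP x) (expM y z)) (ev_twistJ (expM x y) (expP z)).
rewrite (ev_twistJ (expP x) (expP y)) (ev_twistJ (expP y) (expP z)).
apply: (canLR (mulfK _)); first by rewrite mulf_neq0 ?expf_neq0 ?zeta_neq0.
apply: (canLR (mulfK _)); first by rewrite mulf_neq0 ?expf_neq0 ?zeta_neq0.
(* Without denominators, the identity is one between exponents. *)
rewrite (divnD_carry y.1 z.1 sm_gt0) (divnD_carry y.2 z.2 sn_gt0).
rewrite [LHS]mulrACA [X in _ = X * _]mulrACA [RHS]mulrACA -!exprD.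
congr (_ ^+ _ * _ ^+ _); lia.
Qed.

End TwistAssociatorValues.

(** * Characters of a product of two cyclic groups *)

Section CyclicCharacters.

Variables (k : fieldType) (l : nat) (z : k).
Hypothesis z_prim : l.-primitive_root z.

Let l_gt0 : (0 < l)%N := prim_order_gt0 z_prim.

Definition cyc_char (x : nat) (g : 'I_l.-1.+1) : k := z ^+ (x * g).

Let modn_pred x y : x * (y %% l.-1.+1) = x * y %[mod l].
Proof. by rewrite prednK // modnMmr. Qed.

Lemma cyc_char_is_character x : is_character (cyc_char x).
Proof.
split=> [|g h]; first by rewrite /cyc_char muln0.
rewrite /cyc_char -exprD -mulnDr; apply: (prim_expr_eqmod z_prim) => /=.
exact: modn_pred.
Qed.

Lemma cyc_char_Zp1 x : cyc_char x Zp1 = z ^+ x.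
Proof.
by apply: (prim_expr_eqmod z_prim); rewrite modn_pred muln1.
Qed.

(** The values of [u] at the characters are those of the polynomial with
coefficients [u] at the powers of [z], which are [l] distinct roots. *)
Lemma separating_cyc_char : separating cyc_char.
Proof.
move=> u u0; pose p := \poly_(i < l.-1.+1) u (inord i).
have p_eval x : p.[z ^+ x] = 0.
  rewrite -[RHS](u0 x) horner_poly; apply: eq_bigr => i _.
  by rewrite inord_val /cyc_char exprM.
have p0: p = 0.
  apply: (roots_geq_poly_eq0 (rs := [seq z ^+ i | i <- iota 0 l])).
  - by apply/allP=> _ /mapP[i _ ->]; apply/rootP.
  - rewrite map_inj_in_uniq ?iota_uniq // => i j.
    rewrite !mem_iota !add0n => /andP[_ il] /andP[_ jl] /eqP.
    by rewrite (eq_prim_root_expr z_prim) !modn_small // => /eqP.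
  - by rewrite size_map size_iota -[in leqRHS](prednK l_gt0) size_poly.
apply/ffunP=> i; rewrite ffunE -[i]inord_val.
have := coef_poly l.-1.+1 (fun i => u (inord i)) i.
by rewrite -/p p0 coef0 ltn_ord.
Qed.

End CyclicCharacters.

Lemma separating_comp (k : fieldType) (gT : finGroupType) X
    (chi : X -> gT -> k) (s : {perm gT}) :
  separating chi -> separating (fun x g => chi x (s g)).
Proof.
move=> sep u u0; pose v : galg k gT := [ffun g => u ((s^-1)%g g)].
suffices /ffunP v0: v = 0.
  by apply/ffunP=> g; have := v0 (s g); rewrite !ffunE permK.
apply: sep => x; rewrite -[RHS](u0 x) /ev (reindex_inj (perm_inj (s := s))).
by apply: eq_bigr => g _; rewrite ffunE permK.
Qed.

Theorem proposition5p3 (k : closedFieldType) (sm sn : nat) (zeta : nat -> k)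
    (h1 h2 : Zprod (sm ^ 2) (sn ^ 2)) (a b c : nat) :
  [pchar k] =i pred0 ->
  (0 < sm)%N -> (0 < sn)%N -> (sm ^ 2 %| sn ^ 2)%N ->
  (forall l : nat, (0 < l)%N -> l.-primitive_root (zeta l)) ->
  zeta (sm ^ 2)%N ^+ sm = zeta sm ->
  zeta (sn ^ 2)%N ^+ sn = zeta sn ->
  zeta (sn ^ 2)%N ^+ (sn ^ 2 %/ sm ^ 2) = zeta (sm ^ 2)%N ->
  standard_generators h1 h2 ->
  (a < sm)%N -> (b < sm)%N -> (c < sn)%N ->
  twistJ zeta sm sn h1 h2 a b c \is a GRing.unit /\
  twist_d (twistJ zeta sm sn h1 h2 a b c) = assocPhi zeta sm sn h1 h2 a b c.
Proof.
move=> _ sm_gt0 sn_gt0 m_n zeta_prim zeta_sm zeta_sn _ [s sAut [-> ->]] _ _ _.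
have sm_sn: (sm %| sn)%N by rewrite -(dvdn_pexp2r _ _ (isT : 0 < 2)%N).
have zm_prim: (sm ^ 2).-primitive_root (zeta (sm ^ 2)%N).
  by rewrite zeta_prim // expn_gt0 sm_gt0.
have zn_prim: (sn ^ 2).-primitive_root (zeta (sn ^ 2)%N).
  by rewrite zeta_prim // expn_gt0 sn_gt0.
have sM: {morph s : g h / (g * h)%g}.
  by move=> g h; rewrite -(autmE sAut) morphM ?inE.
(* The characters are transported along the automorphism that takes the
   canonical generators to [h1] and [h2]. *)
pose chi0 (x : nat * nat) :=
  tchar (cyc_char (l := sm ^ 2) (zeta (sm ^ 2)%N) x.1)
        (cyc_char (l := sn ^ 2) (zeta (sn ^ 2)%N) x.2).
have chi0P x : is_character (chi0 x).
  by apply: tchar_is_character; apply: cyc_char_is_character.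
have sep: separating (fun x g => chi0 x (s^-1 g)%g).
  apply: separating_comp.
  by apply: separating_tchar; apply: separating_cyc_char.
apply: (twist_d_twistJ _ _ _ sm_gt0 sn_gt0 sm_sn _ _ _ sep) => // x.
split; [split=> [|g h] | |]; rewrite ?permK.
- have [<- _] := chi0P x; congr (chi0 x _).
  by apply: (perm_inj (s := s)); rewrite permKV -(autmE sAut) morph1.
- have [_ <-] := chi0P x; congr (chi0 x _).
  by apply: (perm_inj (s := s)); rewrite sM !permKV.
- by rewrite /chi0 /tchar /= cyc_char_Zp1 // {1}/cyc_char muln0 mulr1.
- by rewrite /chi0 /tchar /= cyc_char_Zp1 // {1}/cyc_char muln0 mul1r.
Qed.
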